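(* (1) Let $X$ be a separable metric space. If $X$ is an asymptotic cone (that is, $X$ is isometric to $C(Y,p,\nu)$ for some metric space $Y$, some $p\in{}^*Y$ and some $\nu\in{}^*\mathbb{R}$ with $\nu\gg 1$), then $X$ is proper. (2) Let $Y$ be a metric space, $p\in{}^*Y$, and $\mu,\nu\in{}^*\mathbb{R}$ with $\mu\ll\nu$ and $\nu\gg 1$. Suppose that for every scaling factor $\nu'\gg 1$ in ${}^*\mathbb{R}$ with $\mu\leq\nu'\leq\nu$ the asymptotic cone $C(Y,p,\nu')$ is separable, and that $X=C(Y,p,\nu)$ is homogeneous. Then $X$ has finite Hausdorff dimension and finite Minkowski dimension.
   Context: Nonstandard extensions. Fix a non-principal ultrafilter $\mathcal{U}$ on $\mathbb{N}$. For a set $X$, ${}^*X$ is the ultrapower $X^{\mathbb{N}}/\mathcal{U}$ (functions identified if they agree on a set in $\mathcal{U}$), with $X\subseteq{}^*X$ via constant functions; functions and relations (in particular the order and operations of $\mathbb{R}$ and the metric $d$ of a metric space, giving $d:{}^*X\times{}^*X\to{}^*\mathbb{R}$) are extended componentwise modulo $\mathcal{U}$. For $\xi,\eta\in{}^*\mathbb{R}$, $\eta\neq 0$: $\xi\in o(\eta)$ means $\xi/\eta$ is infinitesimal; $\xi\in O(\eta)$ means $\xi/\eta$ is finite, i.e. bounded in absolute value by a standard real; for nonnegative $\xi,\eta$, $\xi\ll\eta$ means $\xi/\eta$ is infinitesimal and $\xi\gg\eta$ means $\xi/\eta$ is infinite. For finite $\xi\in{}^*\mathbb{R}$, $st(\xi)$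 is the unique real with $\xi-st(\xi)$ infinitesimal. Asymptotic cones. Let $(Y,d)$ be a metric space, $p\in{}^*Y$ (basepoint) and $\nu\in{}^*\mathbb{R}$, $\nu\gg 1$ (scaling factor; scaling factors are always infinite). On ${}^*Y$ put $x\sim y\iff d(x,y)\in o(\nu)$. The asymptotic cone is $C(Y,p,\nu)=\{[x]\in{}^*Y/{\sim}\,:\, d(x,p)\in O(\nu)\}$ with metric $d([x],[y])=st(d(x,y)/\nu)$. A metric space is proper if all its closed balls are compact, and homogeneous if its isometry group acts transitively on it. A proper homogeneous metric space $X$ has finite Minkowski dimension if, given $x\in X$, there exist $q>0$ and sequences $\{k_n\}_{n\in\mathbb{N}}$ of natural numbers and $\{r_n\}_{n\in\mathbb{N}}$ of positive reals, with $r_n\to 0$ and $\{k_n r_n^q\}$ bounded, such that for each $n$ the closed ball $\overline{B}(x,1)$ can be covered by $k_n$ balls of radius $r_n$ centered in $\overline{B}(x,1)$. *)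

(* Defs.v *)
From HB Require Import structures.
From mathcomp Require Import all_boot all_order all_algebra.
From mathcomp Require Import all_classical all_reals all_analysis.
From mathcomp Require Import lra.

Set Implicit Arguments.
Unset Strict Implicit.
Unset Printing Implicit Defensive.

Import Order.TTheory GRing.Theory Num.Theory.
Import numFieldNormedType.Exports.

Local Open Scope classical_set_scope.
Local Open Scope ring_scope.
Local Open Scope quotient_scope.

Definition nonprincipal (U : set_system nat) : Prop :=
  forall n : nat, U <> principal_filter n.

Section Ultrapower.
Context (U : set_system nat) {UU : UltraFilter U}.

Lemma ultraI (A B : set nat) : U A -> U B -> U (A `&` B).
Proof. exact: filterI. Qed.

Section Carrier.
Variable X : choiceType.

Definition star_eq (x y : nat -> X) : bool := `[< U [set n | x n = y n] >].

Lemma star_eq_refl : reflexive star_eq.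
Proof.
by move=> x; apply/asboolP; rewrite (_ : mkset _ = setT) ?eqEsubset//; exact: filterT.
Qed.

Lemma star_eq_sym : symmetric star_eq.
Proof.
by move=> x y; apply/asboolP/asboolP; apply: filterS => n /= ->.
Qed.

Lemma star_eq_trans : transitive star_eq.
Proof.
move=> y x z /asboolP xy /asboolP yz; apply/asboolP.
by apply: filterS2 xy yz => n /= -> ->.
Qed.

Canonical star_equiv := EquivRel star_eq star_eq_refl star_eq_sym star_eq_trans.

Definition star := {eq_quot star_equiv}.

Lemma star_piP (x y : nat -> X) :
  U [set n | x n = y n] <-> \pi_star x = \pi_star y.
Proof.
split=> [xy|/eqmodP/asboolP//].
by apply/eqmodP/asboolP.
Qed.

Lemma star_repr (x : nat -> X) : U [set n | repr (\pi_star x) n = x n].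
Proof. by apply/star_piP; rewrite reprK. Qed.

Definition star_cst (a : X) : star := \pi_star (fun _ : nat => a).

End Carrier.

Definition star_map (A B : choiceType) (f : A -> B) (x : star A) : star B :=
  \pi_(star B) (fun n => f (repr x n)).

Definition star_map2 (A B C : choiceType) (f : A -> B -> C)
    (x : star A) (y : star B) : star C :=
  \pi_(star C) (fun n => f (repr x n) (repr y n)).

Definition star_rel (A B : choiceType) (r : A -> B -> Prop)
    (x : star A) (y : star B) : Prop :=
  U [set n | r (repr x n) (repr y n)].

Lemma star_mapE (A B : choiceType) (f : A -> B) (x : nat -> A) :
  star_map f (\pi_(star A) x) = \pi_(star B) (fun n => f (x n)).
Proof.
by apply/star_piP; apply: filterS (star_repr x) => n /= ->.
Qed.

Lemma star_map2E (A B C : choiceType) (f : A -> B -> C)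
    (x : nat -> A) (y : nat -> B) :
  star_map2 f (\pi_(star A) x) (\pi_(star B) y) =
  \pi_(star C) (fun n => f (x n) (y n)).
Proof.
by apply/star_piP; apply: filterS2 (star_repr x) (star_repr y) => n /= -> ->.
Qed.

Lemma star_relE (A B : choiceType) (r : A -> B -> Prop)
    (x : nat -> A) (y : nat -> B) :
  star_rel r (\pi_(star A) x) (\pi_(star B) y) <-> U [set n | r (x n) (y n)].
Proof.
by split=> h; apply: filterS3 h (star_repr x) (star_repr y) => n /= + h1 h2;
  rewrite h1 h2.
Qed.

Section Hyperreals.
Variable R : realType.
Implicit Types xi eta : star R.

Definition star_le xi eta : Prop := star_rel (fun x y : R => x <= y) xi eta.

Definition star_lt xi eta : Prop := star_rel (fun x y : R => x < y) xi eta.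

Definition star_norm xi : star R := star_map (fun x : R => `|x|) xi.

Definition star_sub xi eta : star R := star_map2 (fun x y : R => x - y) xi eta.

Definition star_div xi eta : star R := star_map2 (fun x y : R => x / y) xi eta.

Definition is_infinitesimal xi : Prop :=
  forall e : R, 0 < e -> star_lt (star_norm xi) (star_cst e).

Definition is_finite xi : Prop :=
  exists M : R, star_le (star_norm xi) (star_cst M).

(* o(eta) and O(eta) are meaningful only for eta <> 0; below, eta is always a
   scaling factor. *)
Definition in_o xi eta : Prop := is_infinitesimal (star_div xi eta).

Definition in_O xi eta : Prop := is_finite (star_div xi eta).

Definition much_less xi eta : Prop :=
  [/\ star_le (star_cst 0) xi, star_le (star_cst 0) eta, eta <> star_cst 0 &
      is_infinitesimal (star_div xi eta)].

Definition much_greater xi eta : Prop :=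
  [/\ star_le (star_cst 0) xi, star_le (star_cst 0) eta, eta <> star_cst 0 &
      ~ is_finite (star_div xi eta)].

Definition scaling_factor (nu : star R) : Prop := much_greater nu (star_cst 1).

(* Junk value 0 when xi is not finite. *)
Definition std_part xi : R :=
  xget 0 [set r : R | is_infinitesimal (star_sub xi (star_cst r))].

Lemma starP (A : choiceType) (x : star A) : exists f, x = \pi_(star A) f.
Proof. by exists (repr x); rewrite reprK. Qed.

Lemma star_leE (x y : nat -> R) :
  star_le (\pi_(star R) x) (\pi_(star R) y) <-> U [set n | x n <= y n].
Proof. exact: star_relE. Qed.

Lemma star_ltE (x y : nat -> R) :
  star_lt (\pi_(star R) x) (\pi_(star R) y) <-> U [set n | x n < y n].
Proof. exact: star_relE. Qed.

Lemma is_infinitesimalE (x : nat -> R) : is_infinitesimal (\pi_(star R) x) <->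
  forall e : R, 0 < e -> U [set n | `|x n| < e].
Proof.
rewrite /is_infinitesimal /star_norm star_mapE /star_cst.
by split=> h e /h he; [exact/(iffLR (star_ltE _ _))|exact/(iffRL (star_ltE _ _))].
Qed.

Lemma is_finiteE (x : nat -> R) : is_finite (\pi_(star R) x) <->
  exists M : R, U [set n | `|x n| <= M].
Proof.
rewrite /is_finite /star_norm star_mapE /star_cst.
by split=> -[M] h; exists M; [exact/(iffLR (star_leE _ _))|exact/(iffRL (star_leE _ _))].
Qed.

Lemma st_unique (x : nat -> R) (r : R) :
  (forall e : R, 0 < e -> U [set n | `|x n - r| < e]) ->
  std_part (\pi_(star R) x) = r.
Proof.
move=> xr; rewrite /std_part; case: xgetP => [s _|/(_ r)]; last first.
  by case; rewrite /= /star_sub /star_cst star_map2E; exact/is_infinitesimalE.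
rewrite /= /star_sub /star_cst star_map2E => /is_infinitesimalE xs.
apply/eqP; apply: contrapT => /negP; rewrite -subr_eq0 -normr_gt0 => d0.
have d20 : 0 < `|s - r| / 2 by lra.
have [n /= [h1 h2]] := filter_ex (filterI (xr _ d20) (xs _ d20)).
have := ler_distD (x n) s r; rewrite (distrC s (x n)) => h3; lra.
Qed.

Lemma st_finite (x : nat -> R) : is_finite (\pi_(star R) x) ->
  forall e : R, 0 < e -> U [set n | `|x n - std_part (\pi_(star R) x)| < e].
Proof.
move=> /is_finiteE[M xM].
have [r xr] : exists r : R, x @ U --> r.
  have := @segment_compact R (- M) M; rewrite compact_ultra.
  case/(_ (x @ U)).
  - split=> [|G GG UG]; first exact: fmap_proper_filter.
    apply/seteqP; split=> // A GA; case: (in_ultra_setVsetC (x @^-1` A) UU) => //.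
    move=> /(UG (~` A)) GCA; have [t [At nAt]] := filter_ex (filterI GA GCA).
    by case: (nAt At).
  - rewrite /fmap/=; apply: (filterS _ xM) => n /= h.
    by rewrite in_itv/= -ler_norml.
  - by move=> r [_ ?]; exists r.
have xr' e : 0 < e -> U [set n | `|x n - r| < e].
  move=> e0; have /cvgrPdist_lt/(_ e e0) := xr.
  by apply: filterS => n /=; rewrite distrC.
by rewrite (st_unique xr').
Qed.

End Hyperreals.

End Ultrapower.

Arguments star U {UU} X.

Section AsymptoticCone.
Context (U : set_system nat) {UU : UltraFilter U}.
Variables (R : realType) (Y : metricType R).

Definition star_dist (x y : star U Y) : star U R :=
  star_map2 (fun a b : Y => mdist a b) x y.

Lemma star_distE (x y : nat -> Y) :
  star_dist (\pi_(star U Y) x) (\pi_(star U Y) y) =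
  \pi_(star U R) (fun n => mdist (x n) (y n)).
Proof. exact: star_map2E. Qed.

Section Cone.
Variables (p : star U Y) (nu : star U R) (nu_inf : scaling_factor nu).

Let nu_pos : U [set n | 0 < repr nu n].
Proof.
have [+ _ _] := nu_inf; rewrite -{1 2}(reprK nu) /star_cst.
rewrite /star_div star_map2E => /star_leE nu0 nufin.
have [v0|v0] := in_ultra_setVsetC [set n | repr nu n = 0] UU.
  exfalso; apply: nufin; apply/is_finiteE; exists 0.
  by apply: (filterS _ v0) => n /= ->; rewrite mul0r normr0.
by apply: filterS2 nu0 v0 => n /= h1 /eqP h2; rewrite lt_neqAle eq_sym h2.
Qed.

Lemma scaled_distE (x y : nat -> Y) :
  star_div (star_dist (\pi_(star U Y) x) (\pi_(star U Y) y)) nu =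
  \pi_(star U R) (fun n => mdist (x n) (y n) / repr nu n).
Proof.
rewrite star_distE; move: (reprK nu); set v := repr nu => vE.
by rewrite -[X in star_div _ X]vE /star_div star_map2E.
Qed.

Definition cone_eq (x y : star U Y) : bool := `[< in_o (star_dist x y) nu >].

Lemma cone_eqE (x y : nat -> Y) :
  cone_eq (\pi_(star U Y) x) (\pi_(star U Y) y) <->
  forall e : R, 0 < e -> U [set n | mdist (x n) (y n) / repr nu n < e].
Proof.
rewrite /cone_eq /in_o scaled_distE; split=> [/asboolP/is_infinitesimalE h|h].
  by move=> e /h; apply: filterS => n; exact: le_lt_trans (ler_norm _).
apply/asboolP/is_infinitesimalE => e /h h'.
apply: filterS2 nu_pos h' => n /= nu0.
by rewrite ger0_norm// divr_ge0 ?mdist_ge0// ltW.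
Qed.

Lemma cone_eq_refl : reflexive cone_eq.
Proof.
move=> x; have [f ->] := starP x; apply/cone_eqE => e e0.
by apply: filterS (@filterT _ U _) => n _ /=; rewrite mdistxx mul0r.
Qed.

Lemma cone_eq_sym : symmetric cone_eq.
Proof.
move=> x y; have [f ->] := starP x; have [g ->] := starP y.
by apply/idP/idP => /cone_eqE h; apply/cone_eqE => e /h;
  apply: filterS => n /=; rewrite metric_sym.
Qed.

Lemma cone_eq_trans : transitive cone_eq.
Proof.
move=> y x z; have [f ->] := starP x; have [g ->] := starP y.
have [h ->] := starP z.
move=> /cone_eqE fg /cone_eqE gh; apply/cone_eqE => e e0.
have e20 : 0 < e / 2 by rewrite divr_gt0.
apply: filterS3 nu_pos (gh _ e20) (fg _ e20) => n /= nu0 h1 h2.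
rewrite (splitr e); apply: le_lt_trans (ltrD h2 h1).
by rewrite -mulrDl ler_pM2r ?invr_gt0// metric_triangle.
Qed.

Canonical cone_equiv :=
  EquivRel cone_eq cone_eq_refl cone_eq_sym cone_eq_trans.

Definition cone_set : set {eq_quot cone_equiv} :=
  [set \pi x | x in [set x : star U Y | in_O (star_dist x p) nu]].

Definition cone : Type := set_type cone_set.
HB.instance Definition _ := Choice.on cone.

(* Independent of the representatives: see cone_distE. *)
Definition cone_dist (a b : cone) : R :=
  std_part (star_div (star_dist (repr (val a)) (repr (val b))) nu).

Let coneP (a : cone) : exists x : nat -> Y,
  (exists M : R, U [set n | mdist (x n) (repr p n) / repr nu n <= M]) /\
  repr (val a) = \pi_(star U Y) x.
Proof.
case: a => /= c /set_mem[y yO <-]; exists (repr (repr (\pi_{eq_quot cone_equiv} y))).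
split; last by rewrite reprK.
have /cone_eqE : cone_eq (\pi_(star U Y) (repr (repr (\pi_{eq_quot cone_equiv} y))))
    (\pi_(star U Y) (repr y)).
  by rewrite !reprK; apply/eqmodP; rewrite reprK.
move=> /(_ 1 ltr01) h1.
move: yO; rewrite /= /in_O -[X in star_dist X _]reprK -[X in star_dist _ X]reprK.
rewrite scaled_distE => /is_finiteE[M h2]; exists (1 + M).
apply: filterS3 nu_pos h1 h2 => n /= nu0 /ltW h1 h2.
apply: le_trans (lerD h1 (le_trans (ler_norm _) h2)).
by rewrite -mulrDl ler_pM2r ?invr_gt0// metric_triangle.
Qed.

Let cone_finite (a b : cone) (x y : nat -> Y) :
  repr (val a) = \pi_(star U Y) x -> repr (val b) = \pi_(star U Y) y ->
  forall e : R, 0 < e ->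
    U [set n | `|mdist (x n) (y n) / repr nu n - cone_dist a b| < e].
Proof.
move=> ax byy; rewrite /cone_dist ax byy scaled_distE; apply: st_finite.
have [x' [[M xM] ax']] := coneP a; have [y' [[N yN] by']] := coneP b.
have xx' : U [set n | x n = x' n] by apply/(iffRL (star_piP _ _)); rewrite -ax.
have yy' : U [set n | y n = y' n] by apply/(iffRL (star_piP _ _)); rewrite -byy.
apply/is_finiteE; exists (M + N).
have h := @ultraI U UU _ _ xx' yy'; have h' := @ultraI U UU _ _ xM yN.
apply: filterS3 nu_pos h h' => n /= nu0 [-> ->] [h1 h2].
rewrite ger0_norm ?divr_ge0 ?mdist_ge0 ?(ltW nu0)//.
apply: le_trans (lerD h1 h2); rewrite -mulrDl ler_pM2r ?invr_gt0//.
by rewrite (metric_sym (y' n)) metric_triangle.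
Qed.

Lemma cone_distE (a b : cone) (x y : star U Y) :
  val a = \pi x -> val b = \pi y ->
  cone_dist a b = std_part (star_div (star_dist x y) nu).
Proof.
have eqr (c : cone) (z : star U Y) : val c = \pi z -> cone_eq (repr (val c)) z.
  by move=> cz; apply/eqmodP; rewrite reprK.
move=> /eqr; have [x' [_ ax']] := coneP a; have [f ->] := starP x.
rewrite ax' => /cone_eqE xf.
move=> /eqr; have [y' [_ by']] := coneP b; have [g ->] := starP y.
rewrite by' => /cone_eqE yg.
rewrite scaled_distE; apply/esym/st_unique => e e0.
have e30 : 0 < e / 3 by rewrite divr_gt0.
have h := @ultraI U UU _ _ (xf _ e30) (yg _ e30).
apply: filterS3 nu_pos h (cone_finite ax' by' e30) => n /= nu0 [h1 h2] h3.
have t1 := metric_triangle (f n) (x' n) (g n).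
have t2 := metric_triangle (x' n) (y' n) (g n).
have t3 := metric_triangle (x' n) (f n) (y' n).
have t4 := metric_triangle (f n) (g n) (y' n).
rewrite (metric_sym (f n) (x' n)) in t1.
rewrite (metric_sym (g n) (y' n)) in t4.
set i := (repr nu n)^-1 in h1 h2 h3 *.
have i0 : 0 < i by rewrite invr_gt0.
have u1 : mdist (f n) (g n) * i <=
    mdist (x' n) (f n) * i + mdist (x' n) (y' n) * i + mdist (y' n) (g n) * i.
  by rewrite -!mulrDl ler_pM2r// -addrA (le_trans t1)// lerD2l.
have u2 : mdist (x' n) (y' n) * i <=
    mdist (x' n) (f n) * i + mdist (f n) (g n) * i + mdist (y' n) (g n) * i.
  by rewrite -!mulrDl ler_pM2r// -addrA (le_trans t3)// lerD2l.
move: h1 h2 h3 u1 u2; clear.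
move: (mdist (x' n) (f n) * i) (mdist (y' n) (g n) * i) => a1 b1.
move: (mdist (x' n) (y' n) * i) (mdist (f n) (g n) * i) => c1 d1.
move: (cone_dist a b) => t; rewrite !ltr_norml => h1 h2 /andP[h3 h4] u1 u2.
by apply/andP; split; lra.
Qed.

Let cone_distxx (a : cone) : cone_dist a a = 0.
Proof.
have [x [_ ax]] := coneP a.
rewrite /cone_dist ax scaled_distE; apply: st_unique => e e0.
apply: filterS (@filterT _ U _) => n _ /=.
by rewrite mdistxx mul0r subr0 normr0.
Qed.

Let cone_dist_eq0 (a b : cone) : cone_dist a b = 0 -> a = b.
Proof.
have [x [_ ax]] := coneP a; have [y [_ byy]] := coneP b => ab0.
apply: val_inj; rewrite -[LHS]reprK -[RHS]reprK; apply/eqmodP.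
change (is_true (cone_eq (repr (val a)) (repr (val b)))).
rewrite ax byy; apply/cone_eqE => e e0.
apply: filterS (cone_finite ax byy e0) => n /=.
by rewrite ab0 subr0; exact: le_lt_trans (ler_norm _).
Qed.

Let cone_dist_sym (a b : cone) : cone_dist a b = cone_dist b a.
Proof.
have [x [_ ax]] := coneP a; have [y [_ byy]] := coneP b.
rewrite {2}/cone_dist ax byy scaled_distE; apply/esym/st_unique => e e0.
by apply: filterS (cone_finite ax byy e0) => n /=; rewrite metric_sym.
Qed.

Let cone_dist_triangle (b a c : cone) :
  cone_dist a c <= cone_dist a b + cone_dist b c.
Proof.
have [x [_ ax]] := coneP a; have [y [_ byy]] := coneP b.
have [z [_ cz]] := coneP c.
apply/ler_addgt0Pl => /= e e0.
have e30 : 0 < e / 3 by rewrite divr_gt0.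
have h := @ultraI U UU _ _ nu_pos (cone_finite ax cz e30).
have h' := @ultraI U UU _ _ (cone_finite ax byy e30) (cone_finite byy cz e30).
have [n /= [[nu0 +] []]] := filter_ex (@ultraI U UU _ _ h h').
have : mdist (x n) (z n) / repr nu n <=
    mdist (x n) (y n) / repr nu n + mdist (y n) (z n) / repr nu n.
  by rewrite -mulrDl ler_pM2r ?invr_gt0// metric_triangle.
clear; move: (_ / _) (_ / _) (_ / _) => a1 b1 c1.
move: (cone_dist a c) (cone_dist a b) (cone_dist b c) => t u v.
by rewrite !ltr_norml => ? /andP[? ?] /andP[? ?] /andP[? ?]; lra.
Qed.

HB.instance Definition _ := @isMetric.Build R cone cone_dist
  cone_distxx cone_dist_eq0 cone_dist_sym cone_dist_triangle.

End Cone.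

End AsymptoticCone.

Section MetricNotions.
Variable R : realType.

Definition separable_space (T : topologicalType) : Prop :=
  exists2 A : set T, countable A & dense A.

Definition metric_isometry (X Y : metricType R) (f : X -> Y) : Prop :=
  (forall x y, mdist (f x) (f y) = mdist x y) /\ bijective f.

Definition isometric (X Y : metricType R) : Prop :=
  exists f : X -> Y, metric_isometry f.

Definition homogeneous_space (X : metricType R) : Prop :=
  forall x y : X, exists2 f : X -> X, metric_isometry f & f x = y.

(* Not the library's closed_ball, which is the closure of the open ball. *)
Definition cball (X : metricType R) (x : X) (r : R) : set X :=
  [set y | mdist x y <= r].

Definition proper_space (X : metricType R) : Prop :=
  forall (x : X) (r : R), compact (cball x r).

Definition is_asymptotic_cone (U : set_system nat) {UU : UltraFilter U}
    (X : metricType R) : Prop :=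
  exists (Y : metricType R) (p : star U Y) (nu : star U R)
    (nu_inf : scaling_factor nu), isometric X (cone p nu_inf).

(* The notion is only defined for proper homogeneous spaces, whence the first
   two conjuncts. *)
Definition finite_Minkowski_dim (X : metricType R) : Prop :=
  [/\ proper_space X, homogeneous_space X &
  forall x : X, exists (q : R) (k : nat -> nat) (r : nat -> R),
    [/\ 0 < q,
        forall n, 0 < r n,
        r n @[n --> \oo] --> (0 : R),
        exists M : R, forall n, (k n)%:R * r n `^ q <= M &
        forall n, exists2 c : 'I_(k n) -> X,
          forall i, cball x 1 (c i) &
          cball x 1 `<=` \bigcup_i ball (c i) (r n)]].

Local Open Scope ereal_scope.

(* -oo on the empty set *)
Definition diam (X : metricType R) (A : set X) : \bar R :=
  ereal_sup [set (mdist x y)%:E | x in A & y in A].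

(* The usual conventions for s = 0: value 0 on the empty set and 1 (= 0 `^ 0)
   on the other sets of diameter 0. *)
Definition diam_pow (X : metricType R) (s : R) (A : set X) : \bar R :=
  if pselect (A = set0) then 0 else diam A `^ s.

Definition Hausdorff_premeasure (X : metricType R) (s delta : R) (A : set X) :
    \bar R :=
  ereal_inf [set \sum_(0 <= i <oo) diam_pow s (C i) |
    C in [set C : nat -> set X |
      (forall i, diam (C i) <= delta%:E) /\ A `<=` \bigcup_i C i]].

Definition Hausdorff_measure (X : metricType R) (s : R) (A : set X) : \bar R :=
  ereal_sup [set Hausdorff_premeasure s delta A |
    delta in [set delta : R | (0 < delta)%R]].

Definition Hausdorff_dim (X : metricType R) : \bar R :=
  ereal_inf [set s%:E |
    s in [set s : R | (0 <= s)%R /\ Hausdorff_measure s [set: X] = 0]].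

Definition finite_Hausdorff_dim (X : metricType R) : Prop :=
  Hausdorff_dim X < +oo.

End MetricNotions.

Arguments is_asymptotic_cone {R} U {UU} X.

(* Main.v *)
Require Import Defs.
From mathcomp Require Import all_boot all_order all_algebra.
From mathcomp Require Import all_classical all_reals all_analysis.
From mathcomp Require Import lra.

(* An infinite internal family of e nu-separated points near p contradicts the
   separability of C(Y, p, nu): by pigeonhole, at each index n one of its
   members avoids the first m n - 1 points of (a lift of) a dense sequence,
   where m n, the number of points at index n, is infinite.  By saturation,
   separability thus bounds the number of separated points by a standard K.
   At a single scale this makes balls totally bounded, and cones are complete.
   When all scales between mu and nu are allowed, saturating over the scale as
   well makes K uniform; since every t nu with t standard lies in that range,
   a ball of radius t around the base point is covered by K balls of radius
   t / 2, and homogeneity moves this to all centers.  Such a doubling space has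
   finite Minkowski and Hausdorff dimension by iterated halving. *)

Import Order.TTheory GRing.Theory Num.Theory.
Import numFieldNormedType.Exports.

Local Open Scope classical_set_scope.
Local Open Scope ring_scope.
Local Open Scope quotient_scope.

Set Implicit Arguments.
Unset Strict Implicit.
Unset Printing Implicit Defensive.

(** * Separated sets, compactness and doubling *)

Lemma exists_half_expn_lt (R : realType) (e : R) :
  0 < e -> exists n, 2^-1 ^+ n < e.
Proof.
move=> e0; have [n _ /(_ n (leqnn n))] := near_infty_natSinv_expn_lt (PosNum e0).
by rewrite div1r -exprVn; exists n.
Qed.

Section MetricSpaces.
Context {R : realType}.
Implicit Types X : metricType R.

Definition separated X (e : R) (K : nat) (x : nat -> X) :=
  forall i j, (i < j < K)%N -> e <= mdist (x i) (x j).

Lemma separable_seq X (x0 : X) : separable_space X ->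
  exists c : nat -> X, forall x e, 0 < e -> exists k, mdist x (c k) < e.
Proof.
move=> [A /countable_injP[f fI] dA].
have h k : exists y, forall a, A a -> f a = k -> y = a.
  case: (pselect (exists2 a, A a & f a = k)) => [[a Aa fa]|n].
    by exists a => b Ab fb; apply: fI; rewrite ?inE ?fb.
  by exists x0 => a Aa fa; exfalso; apply: n; exists a.
have [c hc] := choice h; exists c => x e e0.
have [|y [+ Ay]] := dA (ball x e)° _ (@open_interior _ _).
  by exists x; exact: nbhsx_ballx.
move=> /interior_subset; rewrite ballEmdist /= => xy.
by exists (f y); rewrite (hc _ y).
Qed.

(** A separated family that no point of [A] extends is already a net. By induction on [K], either
    some separated family has one member fewer than the forbidden number, and then nothing extends
    it, or that smaller number is forbidden as well. *)
Lemma finite_net X (A : set X) (a0 : X) (e : R) K : A a0 ->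
  (forall x, (forall i, A (x i)) -> ~ separated e K x) ->
  exists2 c : nat -> X, (forall i, A (c i)) &
    forall a, A a -> exists2 i, (i < K)%N & mdist a (c i) < e.
Proof.
move=> Aa0; elim: K => [|K IH] nsep.
  by exfalso; apply: (nsep (fun=> a0)) => // i j; rewrite ltn0 andbF.
case: (pselect (exists2 x : nat -> X, forall i, A (x i) & separated e K x)).
  move=> [x Ax sx]; exists x => // a Aa; apply: contrapT => far.
  apply: (nsep (fun i => if (i < K)%N then x i else a)).
    by move=> i; case: ifP.
  move=> i j /andP[ij]; rewrite ltnS leq_eqVlt => /orP[/eqP jK|jK].
    subst j; rewrite ij ltnn leNgt; apply/negP => xa; apply: far.
    by exists i; [exact: ltnW|rewrite metric_sym].
  by rewrite jK (ltn_trans ij jK); apply: sx; rewrite ij.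
move=> no; have [|c Ac hc] := IH; first by move=> x Ax sx; apply: no; exists x.
by exists c => // a /hc[i iK h]; exists i => //; exact: ltnW.
Qed.

Lemma ultra_finite_cover (T : Type) (F : set_system T) (B : nat -> set T) K :
  UltraFilter F -> F [set t | exists2 i, (i < K)%N & B i t] ->
  exists2 i, (i < K)%N & F (B i).
Proof.
move=> UF; elim: K => [|K IH] FK.
  by have [t []] := filter_ex FK.
have [FB|FnB] := in_ultra_setVsetC (B K) UF; first by exists K.
have [|i iK FBi] := IH; last by exists i => //; exact: ltnW.
apply: filterS2 FK FnB => t [i]; rewrite ltnS leq_eqVlt => /orP[/eqP->//|iK Bi] _.
by exists i.
Qed.

(* The constant 4 absorbs the factor 2 by which the distances between lifts may
   exceed those between points of a cone. *)
Definition rapidly_complete X := forall a : nat -> X,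
  (forall j k, mdist (a j) (a k) <= 2^-1 ^+ j + 2^-1 ^+ k) ->
  exists b, forall k, mdist b (a k) <= 4 * 2^-1 ^+ k.

Definition finitely_coverable X (A : set X) := forall e, 0 < e ->
  exists (c : nat -> X) K, forall a, A a -> exists2 i, (i < K)%N & mdist a (c i) < e.

(** An ultrafilter on the ball contains, for each [k], one of the finitely many balls of radius
    [2^-k] that cover it. The centers satisfy the estimate of [rapidly_complete], and the
    ultrafilter converges to their limit. *)
Lemma compact_cball X (x : X) r : rapidly_complete X ->
  finitely_coverable (cball x r) -> compact (cball x r).
Proof.
move=> cX tX; rewrite compact_ultra => F UF FA.
have h k : exists a, F [set y | mdist y a < 2^-1 ^+ k].
  have [|c [K hc]] := tX (2^-1 ^+ k); first by rewrite exprn_gt0.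
  have [|i _ Fi] := @ultra_finite_cover _ F
    (fun i => [set y | mdist y (c i) < 2^-1 ^+ k]) K UF.
    by apply: filterS FA => y /hc[i iK yi]; exists i.
  by exists (c i).
have [a ha] := choice h.
have [j k|b hb] := cX a.
  have [y /= [h1 h2]] := filter_ex (filterI (ha j) (ha k)).
  apply: le_trans (metric_triangle _ y _) _.
  by rewrite metric_sym lerD// ltW.
have Fb e : 0 < e -> F [set y | mdist b y < e].
  (* The limit is within [4 * 2^-k] of the center [a k], and the points [y] within [2^-k]: together
     [5 * 2^-k]. *)
  move=> e0; have [|k hk] := @exists_half_expn_lt _ (e / 5); first by rewrite divr_gt0.
  apply: filterS (ha k) => y /= ya.
  have := metric_triangle b (a k) y; have := hb k; rewrite (metric_sym (a k)); lra.
exists b; split; last exact/metricType_numDomainType.fcvgrPdist_lt.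
apply/ler_addgt0Pl => e /Fb be.
have [y [/= h1 h2]] := filter_ex (filterI be FA).
have := metric_triangle x y b; rewrite (metric_sym y); rewrite /cball /= in h2; lra.
Qed.

(** Radii above 1 are left out because in a cone they would correspond to scales above [nu]. Both
    dimensions only involve small radii. *)
Definition doubling X K := forall (x : X) e, 0 < e <= 1 ->
  exists c : nat -> X, forall a, mdist x a <= e ->
  exists2 i, (i < K)%N & mdist (c i) a <= e / 2.

Lemma doubling_cover X K : doubling X K -> forall n (x : X),
  exists c : nat -> X, forall a, mdist x a <= 1 ->
  exists2 i, (i < K ^ n)%N & mdist (c i) a <= 2^-1 ^+ n.
Proof.
move=> dX; elim=> [|n IH] x; first by exists (fun=> x) => a xa; exists 0%N.
have [c hc] := IH x.
have he : 0 < (2^-1 ^+ n : R) <= 1.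
  by rewrite exprn_gt0//= exprn_ile1// invf_le1// ler1n.
have [d hd] := choice (fun y => dX y _ he).
exists (fun i => d (c (i %/ K)%N) (i %% K)%N) => a /hc[i iK /hd[j jK cj]].
exists (i * K + j)%N.
  rewrite expnSr (@leq_trans (i.+1 * K)%N) ?leq_mul2r ?iK ?orbT//.
  by rewrite mulSn addnC ltn_add2r.
by rewrite divnMDl ?divn_small ?addn0 ?modnMDl ?modn_small// 1?(leq_ltn_trans _ jK)// exprSr.
Qed.

(** A center whose small ball meets the unit ball is replaced by a point of the intersection, which
    at most doubles the radius. Two extra halvings pay for this and for the strict inequality. *)
Lemma doubling_cover_centered X K : doubling X K -> forall n (x : X),
  exists2 c : nat -> X, forall i, cball x 1 (c i) &
  forall a, cball x 1 a ->
  exists2 i, (i < K ^ n.+2)%N & mdist (c i) a < 2^-1 ^+ n.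
Proof.
move=> dX n x; have [c hc] := doubling_cover dX n.+2 x.
have h i : exists y, cball x 1 y /\ forall a, cball x 1 a ->
    mdist (c i) a <= 2^-1 ^+ n.+2 -> mdist (c i) y <= 2^-1 ^+ n.+2.
  case: (pselect (exists2 y, cball x 1 y & mdist (c i) y <= 2^-1 ^+ n.+2)).
    by move=> [y xy cy]; exists y.
  move=> no; exists x; split; first by rewrite /cball/= mdistxx.
  by move=> a xa ca; exfalso; apply: no; exists a.
have [d hd] := choice h; exists d => [i|a xa]; first by have [] := hd i.
have [i iK ca] := hc a xa; exists i => //.
have := (hd i).2 a xa ca; have := metric_triangle (d i) (c i) a.
have : 0 < (2^-1 ^+ n : R) by rewrite exprn_gt0.
rewrite (metric_sym (d i) (c i)); move: ca; rewrite !exprS; set p := 2^-1 ^+ n; lra.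
Qed.

(** A crude bound on the binary logarithm of [K]; it provides the exponents in both dimension
    estimates. *)
Lemma natr_le_expn2 K : (K%:R : R) <= 2 ^+ K.+1.
Proof.
have : (K <= 2 ^ K.+1)%N by rewrite ltnW// (leq_trans (@ltn_expl 2 K _))// leq_exp2l.
by rewrite -(ler_nat R) natrX.
Qed.

Lemma doubling_finite_Minkowski_dim X K : proper_space X ->
  homogeneous_space X -> doubling X K -> finite_Minkowski_dim X.
Proof.
move=> pX hX dX; split=> // x.
(* With [q = K + 1] the product to bound is [K ^ 2 * (K / 2 ^ (K + 1)) ^ n], and the base of the
   last power is at most 1. *)
exists K.+1%:R, (fun n => (K ^ n.+2)%N), (fun n => 2^-1 ^+ n); split => //.
- apply: cvg_expr; rewrite ger0_norm//; lra.
- exists (K%:R ^+ 2) => n.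
  rewrite /= powR_mulrn; last by rewrite exprn_ge0.
  rewrite -exprM mulnC exprM natrX -addn2 exprD mulrAC -exprMn ler_piMl ?exprn_ge0//.
  rewrite exprn_ile1// ?mulr_ge0 ?exprn_ge0//.
  by rewrite exprVn ler_pdivrMr ?exprn_gt0// mul1r natr_le_expn2.
- move=> n; have [c xc hc] := doubling_cover_centered dX n x.
  exists (fun i => c i) => [i|a /hc[i iK ca]]; first exact: xc.
  by exists (Ordinal iK) => //; rewrite ballEmdist.
Qed.

End MetricSpaces.

(** * Hausdorff dimension of doubling spaces *)

Section Hausdorff.
Context {R : realType}.
Implicit Types X : metricType R.
Local Open Scope ereal_scope.

Lemma diam_le X (A : set X) (t : R) :
  (forall x y, A x -> A y -> (mdist x y <= t)%R) -> diam A <= t%:E.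
Proof.
by move=> h; apply: ge_ereal_sup => _ [x Ax [y Ay <-]]; rewrite lee_fin h.
Qed.

Lemma diam_ge0 X (A : set X) x : A x -> 0 <= diam A.
Proof.
move=> Ax; apply: ereal_sup_ubound; exists x => //; exists x => //.
by rewrite mdistxx.
Qed.

Lemma diam_pow_ge0 X s (A : set X) : 0 <= diam_pow s A.
Proof. by rewrite /diam_pow; case: (pselect (A = set0)) => //= _; exact: poweR_ge0. Qed.

Lemma diam_pow_set0 X s : diam_pow s (@set0 X) = 0.
Proof. by rewrite /diam_pow; case: (pselect (set0 = set0)). Qed.

Lemma diam_pow_le X (s t : R) (A : set X) : (0 <= s)%R -> (0 <= t)%R ->
  diam A <= t%:E -> diam_pow s A <= (t `^ s)%:E.
Proof.
move=> s0 t0 At; rewrite /diam_pow; case: (pselect (A = set0)) => /= [_|/eqP/set0P[x Ax]].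
  by rewrite lee_fin powR_ge0.
rewrite -poweR_EFin; apply: gt0_ler_poweR => //; rewrite in_itv/= leey andbT ?lee_fin//.
exact: diam_ge0 Ax.
Qed.

Lemma Hausdorff_premeasure_ge0 X s delta (A : set X) :
  0 <= Hausdorff_premeasure s delta A.
Proof.
apply: le_ereal_inf_tmp => _ [C _ <-]; apply: nneseries_ge0 => i _ _.
exact: diam_pow_ge0.
Qed.

(** Covering each ball of a countable cover separately yields a doubly indexed cover. A bijection
    between [nat] and pairs flattens it, and sums of nonnegative terms can be rearranged. *)
Lemma Hausdorff_premeasure_le_double X s delta (A : set X)
    (C : nat -> nat -> set X) : (forall m l, diam (C m l) <= delta%:E) ->
  A `<=` \bigcup_m \bigcup_l C m l ->
  Hausdorff_premeasure s delta A <=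
    \sum_(0 <= m <oo) \sum_(0 <= l <oo) diam_pow s (C m l).
Proof.
move=> Cd AC; have /card_esym/ppcard_eqP[e] := card_nat2.
apply: ge_ereal_inf; exists (\sum_(0 <= i <oo) diam_pow s (C (e i).1 (e i).2)).
  exists (fun i => C (e i).1 (e i).2) => //; split=> // a /AC[m _ [l _ Ca]].
  by exists (e^-1%FUN (m, l)) => //; rewrite invK ?inE.
rewrite nneseries_esumT; last by move=> n; exact: diam_pow_ge0.
rewrite -(@reindex_esum _ _ _ setT setT e (fun k => diam_pow s (C k.1 k.2))); last first.
  exact: bij.
rewrite -[X in \esum_(_ in X) _](_ : setT `*`` (fun=> setT) = setT); last first.
  by apply/seteqP; split.
rewrite -(@esum_esum _ _ _ _ _ (fun m l => diam_pow s (C m l))); last first.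
  by move=> *; exact: diam_pow_ge0.
rewrite nneseries_esumT; last first.
  by move=> n; apply: nneseries_ge0 => *; exact: diam_pow_ge0.
apply: le_esum => m _; rewrite nneseries_esumT// => l; exact: diam_pow_ge0.
Qed.

Lemma sum_diam_pow_le X (s t : R) (C : nat -> set X) L : (0 <= s)%R ->
  (0 <= t)%R -> (forall l, diam (C l) <= t%:E) ->
  (forall l, (L <= l)%N -> C l = set0) ->
  \sum_(0 <= l <oo) diam_pow s (C l) <= (L%:R * t `^ s)%:E.
Proof.
move=> s0 t0 Ct C0; rewrite (nneseries_split _ L); last by move=> *; exact: diam_pow_ge0.
rewrite [X in _ + X]eseries0 ?adde0; last by move=> i Li _; rewrite C0// diam_pow_set0.
rewrite add0n; apply: le_trans (_ : \sum_(0 <= k < L) (t `^ s)%:E <= _).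
  by apply: lee_sum => i _; exact: diam_pow_le.
by rewrite sumEFin sumr_const_nat subn0 mulr_natl.
Qed.

(** Separability gives countably many unit balls covering the space. The exponent [K + 2], one more
    than for the Minkowski dimension, makes the cost of covering one of them at scale [2^-n] at most
    [M * 2^-n], so the measure vanishes. *)
Lemma doubling_finite_Hausdorff_dim X K (x0 : X) : separable_space X ->
  doubling X K -> finite_Hausdorff_dim X.
Proof.
move=> sX dX; have [x hx] := separable_seq x0 sX.
pose M : R := (K%:R ^+ 2 * 2 ^+ K.+2)%R.
have M0 : (0 <= M)%R by rewrite mulr_ge0 ?exprn_ge0.
have count n : ((K ^ n.+2)%:R * (2 * 2^-1 ^+ n) `^ K.+2%:R <= M * 2^-1 ^+ n)%R.
  rewrite powR_mulrn ?mulr_ge0 ?exprn_ge0// exprMn -exprM mulnC exprM natrX.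
  rewrite -addn2 exprD (mulrC (K%:R ^+ n)%R) mulrACA -/M -exprMn ler_wpM2l//.
  have hK : (K%:R * 2^-1 ^+ K.+2 <= 2^-1 :> R)%R.
    rewrite exprS mulrCA ler_piMr// exprVn ler_pdivrMr ?exprn_gt0// mul1r.
    exact: natr_le_expn2.
  have h0 : (0 <= K%:R * 2^-1 ^+ K.+2 :> R)%R by rewrite mulr_ge0// exprn_ge0.
  by apply: lerXn2r hK; rewrite nnegrE ?h0// invr_ge0.
suff mu0 : Hausdorff_measure K.+2%:R [set: X] = 0.
  by apply: le_lt_trans (ltry K.+2%:R%R); apply: ereal_inf_lbound; exists K.+2%:R%R.
apply/eqP; rewrite eq_le; apply/andP; split; last first.
  apply: le_trans (Hausdorff_premeasure_ge0 K.+2%:R%R 1%R [set: X]) _.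
  by apply: ereal_sup_ubound; exists 1%R => /=.
apply: ge_ereal_sup => _ [delta /= delta0 <-].
apply/lee_addgt0Pr => eta eta0; rewrite add0e.
(* The first bound keeps all diameters below [delta]; the second makes the cost of the [m]-th ball
   at most [eta / 2 ^ (m + 1)], with total [eta]. Writing [M + 1] avoids a zero denominator when
   [K = 0]. *)
have [n hn] : exists n, (2^-1 ^+ n < Num.min (delta / 2) (eta / (2 * (M + 1))) :> R)%R.
  by apply: exists_half_expn_lt; rewrite lt_min !divr_gt0// mulr_gt0// ltr_wpDl.
move: hn; rewrite lt_min => /andP[hdelta heta].
have h m : exists d : nat -> X, forall a, (mdist (x m) a <= 1)%R ->
    exists2 l, (l < K ^ (n + m).+2)%N & (mdist (d l) a < 2^-1 ^+ (n + m))%R.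
  by have [d _ ?] := doubling_cover_centered dX (n + m) (x m); exists d.
have [d hd] := choice h.
(* Covering the m-th unit ball at scale 2^-(n + m) makes the sums over l decay
   geometrically in m. *)
pose C m l : set X :=
  if (l < K ^ (n + m).+2)%N then [set a | mdist (d m l) a < 2^-1 ^+ (n + m)]%R
  else set0.
have Cd m l : diam (C m l) <= (2 * 2^-1 ^+ (n + m))%:E.
  apply: diam_le => a b; rewrite /C; case: ifP => //= _ da db.
  apply: le_trans (metric_triangle _ (d m l) _) _; rewrite (metric_sym a); lra.
have half_le m : (2^-1 ^+ (n + m) <= 2^-1 ^+ n :> R)%R.
  by rewrite exprD ler_piMr ?exprn_ge0// exprn_ile1// invf_le1// ler1n.
apply: le_trans (@Hausdorff_premeasure_le_double _ _ _ _ C _ _) _.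
- move=> m l; apply: le_trans (Cd m l) _; rewrite lee_fin.
  have := half_le m; lra.
- move=> a _; have [m xm] := hx a 1%R ltr01; exists m => //.
  have [|l lK la] := hd m a; first by rewrite metric_sym ltW.
  by exists l => //; rewrite /C lK.
apply: le_trans (_ : \sum_(0 <= m <oo) (eta / (2 ^ m.+1)%:R)%:E <= _); last first.
  exact: epsilon_trick0 (ltW eta0).
apply: lee_nneseries => [m _ _|m _].
  by apply: nneseries_ge0 => *; exact: diam_pow_ge0.
apply: le_trans (@sum_diam_pow_le _ _ _ _ (K ^ (n + m).+2) _ _ (Cd m) _) _ => //.
  by move=> l Kl; rewrite /C ltnNge Kl.
rewrite lee_fin; apply: le_trans (count _) _.
rewrite exprD natrX -exprVn exprS !mulrA ler_pM2r ?exprn_gt0//.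
move: heta; rewrite ltr_pdivlMr ?mulr_gt0 ?ltr_wpDl// => heta.
rewrite ler_pdivlMr//; apply: le_trans (ltW heta).
rewrite -mulrA mulrC -mulrA ler_wpM2l ?exprn_ge0//; lra.
Qed.

End Hausdorff.

(** * Saturation and points of cones *)

Lemma filter_forall_ltn (F : set_system nat) {FF : Filter F} K (P : nat -> set nat) :
  (forall i, (i < K)%N -> F (P i)) -> F [set n | forall i, (i < K)%N -> P i n].
Proof.
elim: K => [_|K IH h]; first by apply: filterS filterT => n _ i; rewrite ltn0.
have h' : F [set n | forall i, (i < K)%N -> P i n].
  by apply: IH => i iK; apply: h; exact: ltnW.
apply: filterS2 h' (h K (ltnSn K)) => n h1 h2 i.
by rewrite ltnS leq_eqVlt => /orP[/eqP->|/h1].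
Qed.

Section Ultrafilter.
Context (U : set_system nat) {UU : UltraFilter U} (U_np : nonprincipal U).

(** An ultrafilter containing the singleton of [k] is principal at [k], so each [k] can be removed
    in turn. *)
Lemma ultra_ge k : U [set n | (k <= n)%N].
Proof.
elim: k => [|k IH]; first by apply: filterS filterT.
have [Uk|Unk] := in_ultra_setVsetC [set k] UU; last first.
  by apply: filterS2 IH Unk => n /= kn /eqP nk; rewrite ltn_neqAle eq_sym nk.
exfalso; apply: (U_np (n := k)); apply/seteqP; split => A /=.
  by move=> UA _ /= ->; have [n [/= -> ]] := filter_ex (filterI Uk UA).
by move=> h; apply: filterS Uk => n /h.
Qed.

(* aleph_1-saturation of the ultrapower, in the form of a diagonal argument:
   m is an infinite hypernatural below which the P j hold internally. *)
Lemma ultra_saturation (P : nat -> nat -> Prop) : (forall k, U (P k)) ->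
  exists2 m : nat -> nat, forall k, U [set n | (k <= m n)%N] &
    forall n j, (j < m n)%N -> P j n.
Proof.
(* [m n] will be the largest [k] with [Q n k]; the bound [k <= n] makes this maximum exist. *)
move=> UP; pose Q n k := (k <= n)%N && `[< forall j, (j < k)%N -> P j n >].
have exQ n : exists k, Q n k by exists 0%N; apply/asboolP.
have leQ n k : Q n k -> (k <= n)%N by case/andP.
exists (fun n => ex_maxn (exQ n) (@leQ n)) => [k|n j]; last first.
  by case: ex_maxnP => m /andP[_ /asboolP h] _ /h.
have hk : U [set n | forall i, (i < k)%N -> P i n] by exact: filter_forall_ltn.
apply: filterS2 (ultra_ge k) hk => n /= kn h.
by case: ex_maxnP => m _; apply; rewrite /Q kn; apply/asboolP.
Qed.

Lemma scaling_factorP (R : realType) (nu : star U R) :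
  scaling_factor nu <-> forall M, U [set n | M < repr nu n].
Proof.
move: (reprK nu); set v := repr nu => vE.
rewrite /scaling_factor /much_greater -{1 2}vE /star_cst /star_div star_map2E.
split=> [[/star_leE v0 _ _ nf] M|h].
  have [//|vM] := in_ultra_setVsetC [set n | M < v n] UU.
  exfalso; apply: nf; apply/is_finiteE; exists M.
  apply: filterS2 v0 vM => n /= v0 /negP; rewrite -leNgt => vM.
  by rewrite divr1 ger0_norm.
split.
- by apply/star_leE; apply: filterS (h 0) => n /= /ltW.
- by apply/star_leE; apply: filterS filterT => n _ /=.
- by move=> /(iffRL (star_piP _ _)) /filter_ex[n /= /eqP]; rewrite oner_eq0.
- move=> /is_finiteE[M hM].
  have [n /= []] := filter_ex (filterI hM (h M)).
  by rewrite divr1 => h1 h2; have := le_lt_trans (ler_norm _) (le_lt_trans h1 h2); rewrite ltxx.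
Qed.

End Ultrafilter.

Section Lifts.
Context (U : set_system nat) {UU : UltraFilter U}.
Variables (R : realType) (Y : metricType R) (p : star U Y) (nu : star U R).
Variable (nu_inf : scaling_factor nu).
Notation v := (repr nu).

(** A relation rather than a chosen representative, so that sequences built index by index, such as
    diagonal ones, can serve as lifts. *)
Definition lifts (x : nat -> Y) (a : cone p nu_inf) : Prop :=
  val a = \pi_{eq_quot (cone_equiv Y nu_inf)} (\pi_(star U Y) x).

Lemma scale_gt0 : U [set n | 0 < v n].
Proof. by move/scaling_factorP : nu_inf; exact. Qed.

Lemma lift_exists a : exists x, lifts x a.
Proof. by exists (repr (repr (val a))); rewrite /lifts !reprK. Qed.

Lemma lift_bounded x a : lifts x a ->
  exists M, U [set n | mdist (x n) (repr p n) / v n <= M].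
Proof.
move=> xa; case/set_mem : (valP a) => y yO; rewrite xa => /eqmodP.
rewrite -(reprK y) => /(cone_eqE nu_inf) /(_ 1 ltr01) yx.
move: yO; rewrite /= /in_O -(reprK y) -[X in star_dist _ X]reprK scaled_distE.
move=> /is_finiteE[M yM]; exists (1 + M).
apply: filterS3 scale_gt0 yx yM => n /= v0 /ltW h1 /(le_trans (ler_norm _)) h2.
apply: le_trans (lerD h1 h2); rewrite -mulrDl ler_pM2r ?invr_gt0//.
by rewrite (metric_sym _ (x n)) metric_triangle.
Qed.

Lemma lift_dist x y a b : lifts x a -> lifts y b -> forall e : R, 0 < e ->
  U [set n | `|mdist (x n) (y n) / v n - mdist a b| < e].
Proof.
move=> xa yb; rewrite /mdist /= (cone_distE xa yb) scaled_distE.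
apply: st_finite; apply/is_finiteE.
have [M xM] := lift_bounded xa; have [N yN] := lift_bounded yb; exists (M + N).
apply: filterS3 scale_gt0 xM yN => n /= v0 h1 h2.
rewrite ger0_norm ?divr_ge0 ?mdist_ge0 ?(ltW v0)//.
apply: le_trans (lerD h1 h2); rewrite -mulrDl ler_pM2r ?invr_gt0//.
by rewrite (metric_sym (y n)) metric_triangle.
Qed.

Lemma lift_make x M : U [set n | mdist (x n) (repr p n) / v n <= M] ->
  exists a, lifts x a.
Proof.
move=> xM.
have h : \pi_{eq_quot (cone_equiv Y nu_inf)} (\pi_(star U Y) x) \in
    @cone_set _ _ _ _ p _ nu_inf.
  apply/mem_set; exists (\pi_(star U Y) x) => //=.
  rewrite /in_O -[X in star_dist _ X]reprK scaled_distE; apply/is_finiteE; exists M.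
  apply: filterS2 scale_gt0 xM => n /= v0 h.
  by rewrite ger0_norm ?divr_ge0 ?mdist_ge0 ?(ltW v0).
by exists (exist (fun c => c \in @cone_set _ _ _ _ p _ nu_inf) _ h).
Qed.

Lemma lift_basepoint : exists a, lifts (repr p) a.
Proof.
apply: (@lift_make _ 0); apply: filterS filterT => n _ /=.
by rewrite mdistxx mul0r.
Qed.

Lemma lift_seq (a : nat -> cone p nu_inf) :
  exists x : nat -> nat -> Y, forall k, lifts (x k) (a k).
Proof. by have [x xa] := choice (fun k => lift_exists (a k)); exists x. Qed.

End Lifts.

(** * Packing bounds, completeness and properness of cones *)

(** Otherwise each of the [M + 1] points [x i] is within [e / 2] of one of the [M] points [y j]; two
    of them share the same [y j] and are less than [e] apart. *)
Lemma separated_far (R : realType) (X : metricType R) (x y : nat -> X) M (e : R) :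
  separated e M.+1 x ->
  exists2 i, (i < M.+1)%N & forall j, (j < M)%N -> e / 2 <= mdist (x i) (y j).
Proof.
move=> sx; apply: contrapT => no.
have near_ (i : 'I_M.+1) : exists j : 'I_M, mdist (x i) (y j) < e / 2.
  apply: contrapT => far; apply: no; exists i => // j jM.
  by rewrite leNgt; apply/negP => xy; apply: far; exists (Ordinal jM).
have [g hg] := choice near_.
have g_inj : injective g.
  suff sg (i i' : 'I_M.+1) : (i < i')%N -> g i <> g i'.
    move=> i i' gi; apply/val_inj/eqP; case: ltngtP => // /sg; rewrite gi; exact.
  move=> ii' gi; have := sx i i'; rewrite ii' ltn_ord => /(_ isT).
  have := hg i; have := hg i'; rewrite -gi.
  have := metric_triangle (x i) (y (g i)) (x i').
  rewrite (metric_sym (y _) (x i')); lra.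
by have := leq_card g g_inj; rewrite !card_ord ltnn.
Qed.

Section ConeGeometry.
Context (U : set_system nat) {UU : UltraFilter U} (U_np : nonprincipal U).
Variables (R : realType) (Y : metricType R) (p : star U Y).

(* Every point of a countable dense set is close to at most one of the m n
   points x n i, so by pigeonhole some x n i avoids the first m n - 1 of them. *)
Lemma separable_cone_bounded_packing (nu : star U R) (nu_inf : scaling_factor nu)
    (L e : R) (m : nat -> nat) (x : nat -> nat -> Y) :
  separable_space (cone p nu_inf) -> 0 < e ->
  (forall k, U [set n | (k <= m n)%N]) ->
  ~ U [set n | (forall i, (i < m n)%N -> mdist (x n i) (repr p n) <= L * repr nu n) /\
               separated (e * repr nu n) (m n) (x n)].
Proof.
move=> sep e0 m_inf hx.
have [b0 _] := @lift_basepoint _ _ _ _ p _ nu_inf.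
have [c hc] := separable_seq b0 sep; have [y yc] := lift_seq c.
have h n : exists i, (0 < m n)%N -> separated (e * repr nu n) (m n) (x n) ->
    (i < m n)%N /\ forall j, (j < (m n).-1)%N ->
      e * repr nu n / 2 <= mdist (x n i) (y j n).
  case: (m n) => [|M]; first by exists 0%N.
  case: (pselect (separated (e * repr nu n) M.+1 (x n))) => s; last by exists 0%N.
  by have [i iM hi] := separated_far (y ^~ n) s; exists i.
have [f hf] := choice h.
pose z n := x n (f n).
have v0 := scale_gt0 nu_inf.
have hz : U [set n | mdist (z n) (repr p n) / repr nu n <= L].
  apply: filterS3 hx (m_inf 1%N) v0 => n /= [h1 h2] m1 v0n.
  by rewrite ler_pdivrMr//; apply: h1; have [] := hf n m1 h2.
have [b zb] := lift_make nu_inf hz.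
(* The point [b] is within [e / 4] of some [c k], and passing to lifts costs less than another
   [e / 4], while the lifts are at least [e / 2] apart. *)
have e40 : 0 < e / 4 by rewrite divr_gt0.
have [k bk] := hc b _ e40.
have far : U [set n | e / 2 <= mdist (z n) (y k n) / repr nu n].
  apply: filterS3 hx (m_inf k.+2) v0 => n /= [h1 h2] mk v0n.
  have [|_ /(_ k)] := hf n _ h2; first exact: leq_trans mk.
  rewrite ltn_predRL => /(_ mk) h3.
  by rewrite ler_pdivlMr// mulrAC.
have [n /= [h1 h2]] := filter_ex (filterI far (lift_dist zb (yc k) e40)).
have := le_lt_trans (ler_norm _) h2; move: bk; lra.
Qed.

(** If every [K] failed, saturation would select at each index a scale and a separated family of
    infinite size. The scales define a single [nu] between [lo] and [hi], whose cone contradicts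
    [separable_cone_bounded_packing]. *)
Lemma separable_cones_uniform_packing (lo hi : nat -> R) (L e : R) :
  (forall M, U [set n | M < lo n]) -> U [set n | lo n <= hi n] ->
  (forall (nu : star U R) (nu_inf : scaling_factor nu),
     U [set n | lo n <= repr nu n <= hi n] -> separable_space (cone p nu_inf)) ->
  0 < e ->
  exists K, U [set n | forall w x, lo n <= w <= hi n ->
    (forall i, (i < K)%N -> mdist (x i) (repr p n) <= L * w) ->
    ~ separated (e * w) K (x : nat -> Y)].
Proof.
move=> lo_inf lohi sep e0; apply: contrapT => no.
pose P K n := exists w (x : nat -> Y), [/\ lo n <= w <= hi n,
  forall i, (i < K)%N -> mdist (x i) (repr p n) <= L * w & separated (e * w) K x].
have UP K : U (P K).
  have [//|nP] := in_ultra_setVsetC (P K) UU.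
  exfalso; apply: no; exists K; apply: filterS nP => n nPn w x h1 h2 h3.
  by apply: nPn; exists w, x.
have [m m_inf hm] := ultra_saturation U_np UP.
(* Only the [P j n] with [j < m n] are available, so the family has [(m n).-1] members, still an
   infinite number. *)
have h n : exists wx : R * (nat -> Y), (0 < m n)%N ->
    [/\ lo n <= wx.1 <= hi n, forall i, (i < (m n).-1)%N ->
      mdist (wx.2 i) (repr p n) <= L * wx.1 & separated (e * wx.1) (m n).-1 wx.2].
  case: (posnP (m n)) => [m0|m0]; first by exists (0, fun=> repr p n).
  by have [|w [x hwx]] := hm n (m n).-1; [rewrite prednK|exists (w, x)].
have [g hg] := choice h.
have [nu nuE] : exists nu : star U R, U [set n | repr nu n = (g n).1].
  by exists (\pi_(star U R) (fun n => (g n).1)); exact: star_repr.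
have nu_bnd : U [set n | lo n <= repr nu n <= hi n].
  by apply: filterS2 nuE (m_inf 1%N) => n /= -> /hg[].
have nu_inf : scaling_factor nu.
  apply/scaling_factorP => M; apply: filterS2 nu_bnd (lo_inf M) => n /= /andP[h1 _].
  by move=> /lt_le_trans; exact.
have m'_inf k : U [set n | (k <= (m n).-1)%N].
  by apply: filterS (m_inf k.+1) => n /=; case: (m n).
apply: (@separable_cone_bounded_packing nu nu_inf L e (fun n => (m n).-1) (fun n => (g n).2)) => //.
  exact: sep.
by apply: filterS2 nuE (m_inf 1%N) => n /= -> /hg[].
Qed.

Section OneCone.
Variables (nu : star U R) (nu_inf : scaling_factor nu).
Let v n := repr nu n.

(** Transfers the packing bound from [Y] to the cone: points of the cone are lifted and viewed at
    scale [t * v n]. Radius [L + 1] and separation [e / 2] leave room for the errors of the lifted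
    distances. *)
Lemma cone_uniform_packing (lo : nat -> R) (L e : R) :
  (forall M, U [set n | M < lo n]) -> U [set n | lo n <= v n] ->
  (forall (nu' : star U R) (nu'_inf : scaling_factor nu'),
     U [set n | lo n <= repr nu' n <= v n] -> separable_space (cone p nu'_inf)) ->
  0 < e ->
  exists K, forall t (a : cone p nu_inf) x, lifts (repr p) a ->
    0 < t <= 1 -> U [set n | lo n <= t * v n] ->
    (forall i, mdist a (x i) <= L * t) -> ~ separated (e * t) K x.
Proof.
move=> lo_inf lohi sep e0; have e20 : 0 < e / 2 by rewrite divr_gt0.
have [K hK] := separable_cones_uniform_packing (L + 1) lo_inf lohi sep e20.
exists K => t a x pa /andP[t0 t1] lot xa sx.
have [y yx] := lift_seq x.
have v0 := scale_gt0 nu_inf.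
have hy : U [set n | forall i, (i < K)%N -> mdist (y i n) (repr p n) <= (L + 1) * (t * v n)].
  apply: filter_forall_ltn => i iK.
  apply: filterS2 v0 (lift_dist (yx i) pa t0) => n /= v0n.
  move=> /(le_lt_trans (ler_norm _)) h; rewrite mulrA -ler_pdivrMr//.
  have := xa i; rewrite metric_sym; rewrite /v; lra.
have ty0 : 0 < e / 2 * t by rewrite mulr_gt0.
have hs : U [set n | forall i, (i < K)%N -> forall j, (j < K)%N -> (i < j)%N ->
    e / 2 * (t * v n) <= mdist (y i n) (y j n)].
  apply: filter_forall_ltn => i iK; apply: filter_forall_ltn => j jK.
  apply: filterS2 v0 (lift_dist (yx i) (yx j) ty0) => n /= v0n + ij.
  rewrite ltr_norml => /andP[+ _]; have := sx i j; rewrite ij jK => /(_ isT).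
  rewrite mulrA -(ler_pdivlMr _ _ v0n) /v; lra.
have [n /= [[h1 h2] [[h3 h4] h5]]] :=
  filter_ex (filterI (filterI hK hy) (filterI (filterI hs v0) lot)).
apply: (h1 (t * v n) (fun i => y i n)) => //.
  by rewrite h5 ler_piMl// ltW.
by move=> i j /andP[ij jK]; apply: h3 => //; exact: ltn_trans jK.
Qed.

(** By saturation the lifts satisfy the Cauchy estimates, doubled, up to an infinite index [m n].
    The diagonal sequence taking the lift of index [(m n).-1] at [n] then represents the limit. *)
Lemma cone_rapidly_complete : rapidly_complete (cone p nu_inf).
Proof.
move=> a aC; have [x xa] := lift_seq a.
pose r k : R := 2^-1 ^+ k.
have r0 k : 0 < r k by rewrite exprn_gt0.
have v0 := scale_gt0 nu_inf.
pose P k n := forall j, (j < k.+1)%N ->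
  mdist (x j n) (x k n) / v n < 2 * (r j + r k).
have UP k : U (P k).
  apply: filter_forall_ltn => j _.
  have d0 : 0 < r j + r k by rewrite addr_gt0.
  apply: filterS (lift_dist (xa j) (xa k) d0) => n /= /(le_lt_trans (ler_norm _)).
  have := aC j k; rewrite /v -/(r j) -/(r k); lra.
have [m m_inf hm] := ultra_saturation U_np UP.
pose z n := x (m n).-1 n.
have zx k : U [set n | mdist (z n) (x k n) / v n < 4 * r k].
  apply: filterS (m_inf k.+1) => n /= mk.
  have m0 : (0 < m n)%N by exact: leq_trans mk.
  have := hm n (m n).-1; rewrite /P prednK// => /(_ (leqnn _) k mk).
  rewrite metric_sym => h; apply: lt_le_trans h _.
  have : r (m n).-1 <= r k.
    by rewrite /r ler_wiXn2l// ?invf_le1// ?ler1n// -ltnS prednK.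
  lra.
have [M hM] := lift_bounded (xa 0%N).
have [b zb] : exists b : cone p nu_inf, lifts z b.
  apply: (@lift_make _ _ _ _ _ _ _ _ (4 * r 0%N + M)).
  apply: filterS3 v0 (zx 0%N) hM => n /= v0n /ltW h1 h2.
  apply: le_trans (lerD h1 h2).
  by rewrite -mulrDl ler_pM2r ?invr_gt0// metric_triangle.
exists b => k; apply/ler_addgt0Pl => d d0.
have [n /= [h1]] := filter_ex (filterI (zx k) (lift_dist zb (xa k) d0)).
rewrite ltr_norml => /andP[h2 _]; move: h1 h2; rewrite /v -/(r k); lra.
Qed.

Lemma separable_cone_proper :
  separable_space (cone p nu_inf) -> proper_space (cone p nu_inf).
Proof.
move=> sep x r; apply: compact_cball; first exact: cone_rapidly_complete.
move=> e e0; have [a pa] := @lift_basepoint _ _ _ _ p _ nu_inf.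
(* With [v] as lower bound, [nu] is the only scale in the range. The radius [mdist a x + r] encloses
   the ball about [x] in one about the base point. *)
have [||nu' nu'_inf nu'E|K hK] := @cone_uniform_packing v (mdist a x + r) e _ _ _ e0.
- by apply/scaling_factorP.
- by apply: filterS filterT => n _ /=.
- have E : nu' = nu.
    rewrite -(reprK nu') -(reprK nu); apply/star_piP.
    by apply: filterS nu'E => n /= h; apply/eqP; rewrite eq_le andbC.
  by subst nu'; rewrite (Prop_irrelevance nu'_inf nu_inf).
have [nr|r0] := ltP r 0.
  exists (fun=> x), 0%N => b xb.
  by have := le_trans (mdist_ge0 x b) xb; rewrite leNgt nr.
have [|y xy|c _ hc] := @finite_net _ _ (cball x r) x e K.
- by rewrite /cball/= mdistxx.
- rewrite -(mulr1 e); apply: hK pa _ _ _; first by rewrite ltr01 lexx.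
    by apply: filterS filterT => n _ /=; rewrite mul1r.
  move=> i; rewrite mulr1; apply: le_trans (metric_triangle _ x _) _.
  by rewrite lerD2l; exact: xy.
by exists c, K.
Qed.

End OneCone.
End ConeGeometry.

(** * Isometries, homogeneity and the two dimensions *)

Lemma isometry_continuous (R : realType) (X Z : metricType R) (f : X -> Z) :
  (forall x y, mdist (f x) (f y) = mdist x y) -> continuous f.
Proof.
move=> fd x; apply/metricType_numDomainType.cvgrPdist_lt => e e0.
by apply: filterS (nbhsx_ballx x e e0) => y; rewrite ballEmdist /= fd.
Qed.

Lemma isometric_separable (R : realType) (X Z : metricType R) :
  isometric X Z -> separable_space X -> separable_space Z.
Proof.
move=> [f [fd [g fK gK]]] [A cA dA]; exists (f @` A).
  exact: card_le_trans (card_image_le _ _) cA.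
move=> O [z Oz] oO.
have [||x [Ox Ax]] := dA (f @^-1` O); last by exists (f x); split=> //; exists x.
  by exists (g z); rewrite /preimage/= gK.
by apply: open_comp oO => x _; exact: isometry_continuous.
Qed.

Lemma isometric_proper (R : realType) (X Z : metricType R) :
  isometric X Z -> proper_space Z -> proper_space X.
Proof.
move=> [f [fd [g fK gK]]] pZ x r.
have -> : cball x r = g @` cball (f x) r.
  apply/seteqP; split => [y xy|_ [z xz <-]].
    by exists (f y) => //; rewrite /cball/= fd.
  by rewrite /cball/= -fd gK.
apply: continuous_compact (pZ _ _); apply: continuous_subspaceT.
by apply: isometry_continuous => a b; rewrite -fd !gK.
Qed.

Lemma homogeneous_doubling (R : realType) (X : metricType R) (p : X) K :
  homogeneous_space X ->
  (forall t x, 0 < t <= 1 -> (forall i, mdist p (x i) <= t) ->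
    ~ separated (t / 2) K x) ->
  doubling X K.
Proof.
move=> hX hp x t t01; have [f [fd [g fK gK]] fp] := hX p x.
have [|y xy sy|c _ hc] := @finite_net _ _ (cball x t) x (t / 2) K.
- by rewrite /cball/= mdistxx ltW//; case/andP: t01.
- apply: (hp t (g \o y) t01) => [i|i j ij] /=.
    by rewrite -fd gK fp; exact: xy.
  by rewrite -fd !gK; exact: sy.
by exists c => a /hc[i iK ai]; exists i => //; rewrite metric_sym ltW.
Qed.

(* The scales from max(mu, sqrt nu) to nu are all infinite, and they contain
   t nu for every standard t in (0, 1]. *)
Lemma separable_cones_doubling (R : realType) (U : set_system nat)
    (UU : UltraFilter U) (U_np : nonprincipal U) (Y : metricType R)
    (p : star U Y) (mu nu : star U R) (nu_inf : scaling_factor nu) :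
  much_less mu nu ->
  (forall (nu' : star U R) (nu'_inf : scaling_factor nu'),
     star_le mu nu' -> star_le nu' nu -> separable_space (cone p nu'_inf)) ->
  homogeneous_space (cone p nu_inf) -> exists K, doubling (cone p nu_inf) K.
Proof.
move=> [_ _ _ mu_nu] sep hom.
have mu_le t : 0 < t -> U [set n | repr mu n <= t * repr nu n].
  move=> t0; move: mu_nu; rewrite -(reprK mu) -[X in star_div _ X]reprK.
  rewrite /star_div star_map2E => /is_infinitesimalE /(_ t t0) h.
  rewrite !reprK; apply: filterS2 (scale_gt0 nu_inf) h => n /= v0.
  by move=> /(le_lt_trans (ler_norm _)) /ltW; rewrite ler_pdivrMr.
have nu_big M : U [set n | M < repr nu n] by move: M; apply/scaling_factorP.
pose lo n := Num.max (repr mu n) (Num.sqrt (repr nu n)).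
have lo_le t : 0 < t -> U [set n | lo n <= t * repr nu n].
  (* Once [nu] exceeds [t ^- 2], its square root exceeds [1 / t] and is therefore at most
     [t * nu]. *)
  move=> t0; apply: filterS2 (mu_le t t0) (nu_big (t ^- 2)) => n /= mun nun.
  have v0 : 0 < repr nu n by apply: lt_trans nun; rewrite invr_gt0 exprn_gt0.
  rewrite /lo ge_max mun /=; move: nun; rewrite -[X in _ < X -> _](sqr_sqrtr (ltW v0)).
  rewrite -[X in _ -> _ <= t * X](sqr_sqrtr (ltW v0)).
  have : 0 < Num.sqrt (repr nu n) by rewrite sqrtr_gt0.
  move: (Num.sqrt _) => s s0; rewrite -exprVn ltr_pXn2r ?nnegrE ?invr_ge0 ?(ltW t0) ?(ltW s0)//.
  by move=> ts; rewrite expr2 mulrA ler_peMl ?(ltW s0)// -(mulfV (lt0r_neq0 t0)) ler_pM2l// ltW.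
have half0 : 0 < 2^-1 :> R by rewrite invr_gt0.
have [|||K hK] := @cone_uniform_packing _ _ U_np _ _ p _ nu_inf lo 1 _ _ _ _ half0.
- move=> M; apply: filterS (nu_big (M ^+ 2)) => n /= Mn.
  rewrite /lo lt_max; apply/orP; right.
  apply: le_lt_trans (ler_norm M) _; rewrite -sqrtr_sqr ltr_sqrt//.
  exact: le_lt_trans (sqr_ge0 M) Mn.
- by apply: filterS (lo_le 1 ltr01) => n /=; rewrite mul1r.
- move=> nu' nu'_inf h; apply: sep.
    by apply: filterS h => n /= /andP[+ _]; rewrite /lo ge_max => /andP[].
  by apply: filterS h => n /= /andP[].
- have [a pa] := @lift_basepoint _ _ _ _ p _ nu_inf.
  exists K; apply: (homogeneous_doubling (p := a) hom) => t x t01 xa.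
  rewrite mulrC; apply: (hK t a x pa t01); last by move=> i; rewrite mul1r.
  by case/andP: t01 => t0 _; exact: lo_le.
Qed.

Theorem theorem1p1 (R : realType) (U : set_system nat) (UU : UltraFilter U)
    (U_np : nonprincipal U) :
  (forall X : metricType R,
     separable_space X -> is_asymptotic_cone U X -> proper_space X)
  /\
  (forall (Y : metricType R) (p : star U Y) (mu nu : star U R)
     (nu_inf : scaling_factor nu),
     much_less mu nu ->
     (forall (nu' : star U R) (nu'_inf : scaling_factor nu'),
        star_le mu nu' -> star_le nu' nu ->
        separable_space (cone p nu'_inf)) ->
     homogeneous_space (cone p nu_inf) ->
     finite_Hausdorff_dim (cone p nu_inf) /\
     finite_Minkowski_dim (cone p nu_inf)).
Proof.
split=> [X sepX [Y [p [nu [nu_inf iso]]]]|Y p mu nu nu_inf munu sep hom].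
  apply: (isometric_proper iso); apply: separable_cone_proper => //.
  exact: isometric_separable iso sepX.
have [K dbl] := separable_cones_doubling U_np munu sep hom.
(* The scale [nu] is itself in the allowed range, since its quotient with [mu] is infinitesimal. *)
have sep_nu : separable_space (cone p nu_inf).
  apply: sep; last by apply: filterS filterT => n _ /=.
  have [_ _ _] := munu; rewrite -{1}(reprK mu) -{1}(reprK nu).
  rewrite /star_div star_map2E => /is_infinitesimalE /(_ 1 ltr01) h.
  apply: filterS2 (scale_gt0 nu_inf) h => n /= v0.
  by move=> /(le_lt_trans (ler_norm _)) /ltW; rewrite ler_pdivrMr// mul1r.
have [a _] := @lift_basepoint _ _ _ _ p _ nu_inf.
split; first exact: doubling_finite_Hausdorff_dim a sep_nu dbl.
apply: doubling_finite_Minkowski_dim hom dbl.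
exact: separable_cone_proper.
Qed.
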